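(* Let $\psi$ be a neighbor function with distance parameters $\sigma_1,\dots,\sigma_m$, let $\mu>0$, and let $Q_{\langle G,A_i\rangle}$ be a group-by sum query with disjoint groups $g_1,\dots,g_L$ of establishments. Let $u_{j,i}$ be public upper-bound values attached to each establishment $e_j$. The probably-no-clipping mechanism for $Q_{\langle G,A_i\rangle}$ with budget $\mu$ is: (1) for each group $g_\ell$ compute $u^*_\ell=\max_{e_j\in g_\ell}u_{j,i}$; (2) compute $\Delta_\ell=u^*_\ell-\psi^{-1}\big(\max(0,\psi(u^*_\ell)-\sigma_i)\big)$; (3) compute $T_{g_\ell}=\sum_{e_j\in g_\ell}\min(r_j[A_i],u^*_\ell)$; (4) release, for each group $g_\ell$, $T_{g_\ell}+N(0,(\Delta_\ell/\mu)^2)$ (independent noise across groups) together with the variance $(\Delta_\ell/\mu)^2$. This mechanism satisfies $\mu$-Gaussian Establishment DP with neighbor function $\psi$ and distance parameters $\sigma_1,\dots,\sigma_m$.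
   Context: A neighbor function is a function $\psi:\mathbb{R}_{\geq 0}\to\mathbb{R}$ that is strictly increasing, continuous, concave, and such that $x\mapsto\psi(e^{x})$ is convex. An establishment record $r_j$ (for establishment $e_j$) consists of public attribute values and nonnegative real confidential attribute values $r_j[A_1],\dots,r_j[A_m]$. A dataset is a finite collection of such records. Given nonnegative distance parameters $\sigma_1,\dots,\sigma_m$, a record $r$ is $\psi$-close to $r'$ if their public attribute values coincide and $|\psi(r[A_k])-\psi(r'[A_k])|\leq\sigma_k$ for all $k$. Datasets $D_1,D_2$ are $\psi$-neighbors if one is obtained from the other by replacing one record $r$ with a record $r'$ that is $\psi$-close to $r$. A mechanism $M$ satisfies $\mu$-Gaussian Establishment DP (with $\psi$ and $\sigma_1,\dots,\sigma_m$) if for all pairs of $\psi$-neighbors $D_1,D_2$ and all measurable $S$, $\Phi^{-1}(P(M(D_2)\in S))\leq\Phi^{-1}(P(M(D_1)\in S))+\mu$, with $\Phi$ the standard normal CDF. A group-by sum query $Q_{\langle G,A_i\rangle}$ partitions establishments into groups via a function $G$ of the public attributes only. The upper bounds $u_{j,i}$ are public quantities (in the paper they come from an earlier, separately accounted noisy release of each $\psi(r_j[A_i])$); in this statement they are inputs to the mechanism and are not recomputed from the confidential data.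
   Formalization: The formal statement assumes ψ(0)=0 and nonnegative u_{j,i}: with ψ(0)<0 the claim fails (ψ(x)=x−1, σ=5, u*=2), with ψ(0)>0 the value ψ^{-1}(max(0,ψ(u* )−σ)) may be undefined; other ψ are handled by passing to ψ−ψ(0). *)

(* Defs.v *)
From HB Require Import structures.
From mathcomp Require Import all_boot all_order all_algebra.
From mathcomp Require Import all_classical all_reals all_analysis.
Set Implicit Arguments. Unset Strict Implicit. Unset Printing Implicit Defensive.
Import Order.TTheory GRing.Theory Num.Theory numFieldNormedType.Exports.
Local Open Scope classical_set_scope.
Local Open Scope ring_scope.

Section Defs.
Context {R : realType}.

(** Neighbor function: psi : R_{>=0} -> R (we take psi : R -> R and only
    constrain it on [0, +oo[) strictly increasing, continuous, concave,
    and x |-> psi (e^x) convex. *)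
Definition neighbor_function (psi : R -> R) : Prop :=
  [/\ (forall x y, 0 <= x -> x < y -> psi x < psi y),
      {within [set x : R | 0 <= x], continuous psi},
      (forall x y t, 0 <= x -> 0 <= y -> 0 <= t <= 1 ->
         t * psi x + (1 - t) * psi y <= psi (t * x + (1 - t) * y))
    & (forall x y t, 0 <= t <= 1 ->
         psi (expR (t * x + (1 - t) * y)) <= t * psi (expR x) + (1 - t) * psi (expR y))].

(** Inverse of psi (on its range; generalized inverse in general). *)
Definition psi_inv (psi : R -> R) (y : R) : R :=
  inf [set x : R | 0 <= x /\ y <= psi x].

Record estab_record (P : Type) (m : nat) := EstabRecord {
  pub : P ;
  conf : 'I_m -> R }.

Definition dataset (P : Type) (m : nat) (J : finType) := J -> estab_record P m.

Definition nonneg_dataset P m (J : finType) (D : dataset P m J) : Prop :=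
  forall j k, 0 <= conf (D j) k.

Definition psi_close P m (psi : R -> R) (sigma : 'I_m -> R)
  (r r' : estab_record P m) : Prop :=
  pub r = pub r' /\ forall k, `|psi (conf r k) - psi (conf r' k)| <= sigma k.

Definition psi_neighbors P m (J : finType) (psi : R -> R) (sigma : 'I_m -> R)
  (D1 D2 : dataset P m J) : Prop :=
  exists j, (forall j', j' != j -> D2 j' = D1 j') /\ psi_close psi sigma (D1 j) (D2 j).

(** Standard normal CDF and its inverse (quantile), extended-real valued:
    Phi_inv 0 = -oo, Phi_inv 1 = +oo. *)
Definition Phi (x : R) : \bar R := normal_prob 0 1 `]-oo, x].

Definition Phi_inv (p : \bar R) : \bar R :=
  ereal_inf (EFin @` [set x : R | (p <= Phi x)%E]).

(** mu-Gaussian Establishment DP for a mechanism given by its output law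
    M D : set Out -> \bar R (M D S = P(M(D) \in S)). *)
Definition gaussian_EDP P m (J : finType) d (Out : measurableType d)
  (M : dataset P m J -> set Out -> \bar R)
  (psi : R -> R) (sigma : 'I_m -> R) (mu : R) : Prop :=
  forall D1 D2 : dataset P m J,
    nonneg_dataset D1 -> nonneg_dataset D2 -> psi_neighbors psi sigma D1 D2 ->
    forall S : set Out, measurable S ->
      (Phi_inv (M D2 S) <= Phi_inv (M D1 S) + mu%:E)%E.

Definition gauss_law (c s : R) : set R -> \bar R :=
  if s == 0 then \d_ c else normal_prob c s.

Fixpoint indep_int (nus : seq (set R -> \bar R)) (f : seq R -> \bar R) : \bar R :=
  match nus with
  | [::] => f [::]
  | nu :: nus' => (\int[nu]_x indep_int nus' (fun s => f (x :: s)))%E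
  end.

Section pnc.
Variables (P : Type) (m L : nat) (J : finType).
Variables (psi : R -> R) (sigma : 'I_m -> R) (mu : R) (G : P -> 'I_L)
  (i : 'I_m) (u : J -> R).

Definition ustar (D : dataset P m J) (l : 'I_L) : R :=
  \big[Num.max/0]_(j | G (pub (D j)) == l) u j.

Definition pnc_Delta (D : dataset P m J) (l : 'I_L) : R :=
  ustar D l - psi_inv psi (Num.max 0 (psi (ustar D l) - sigma i)).

Definition group_clipped_sum (D : dataset P m J) (l : 'I_L) : R :=
  \sum_(j | G (pub (D j)) == l) Num.min (conf (D j) i) (ustar D l).

Definition pnc_sd (D : dataset P m J) (l : 'I_L) : R := pnc_Delta D l / mu.

(** Released variances (data independent given the public attributes). *)
Definition pnc_variances (D : dataset P m J) : L.-tuple R :=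
  [tuple pnc_sd D l ^+ 2 | l < L].

Definition pnc_mechanism (D : dataset P m J)
  (S : set (L.-tuple R * L.-tuple R)) : \bar R :=
  indep_int [seq gauss_law (group_clipped_sum D l) (pnc_sd D l) | l <- enum 'I_L]
    (fun s => (\1_[set s : seq R | exists t : L.-tuple R,
                     tval t = s /\ S (t, pnc_variances D)] s)%:E).

End pnc.
End Defs.

(* Main.v *)
Require Import Defs.
From HB Require Import structures.
From mathcomp Require Import all_boot all_order all_algebra.
From mathcomp Require Import all_classical all_reals all_analysis.
From mathcomp Require Import ring lra measurable_realfun.
Import Order.TTheory GRing.Theory Num.Theory numFieldNormedType.Exports.
Local Open Scope classical_set_scope.
Local Open Scope ring_scope.

(* Neighbouring datasets share their public attributes, so every scale
   [Delta_l / mu] is the same for both and only one group sum changes.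
   Concavity of [psi] moves the worst case of the clipped change up against the
   clipping bound, where it equals [Delta_l].

   For two Gaussians whose means differ by at most [mu] standard deviations,
   comparing a test [g] with the likelihood-ratio test [A] that has probability
   [Phi x] under the first one gives the Neyman-Pearson inequality
     E' g + l * Phi x <= l * E g + P' A,   with P' A <= Phi (x + mu).
   Being affine in [g], it survives integration against the noise of the other
   groups.  Hence [P(M D1 \in S) <= Phi x] implies
   [P(M D2 \in S) <= Phi (x + mu)] for every [x], which is the claim on
   [Phi_inv]. *)

(** * Sensitivity of clipped values under [psi]-closeness *)

Section clipping.
Context {R : realType}.
Variable psi : R -> R.
Hypothesis neighbor_psi : neighbor_function psi.

Let psi_homo x y : 0 <= x -> x <= y -> psi x <= psi y.
Proof.
case: neighbor_psi => incr _ _ _ x0; rewrite le_eqVlt => /predU1P[->//|xy].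
exact/ltW/incr.
Qed.

(** Both [b] and [a + h] are convex combinations of the endpoints [a] and [b + h], with weights [t]
    and [1 - t] exchanged; the two concavity inequalities add up to the claim. *)
Lemma neighbor_function_increment a b h : 0 <= a -> a <= b -> 0 <= h ->
  psi (b + h) - psi (a + h) <= psi b - psi a.
Proof.
case: neighbor_psi => _ _ concave_psi _ a0 ab h0.
(* The weight [t] divides by the distance between the endpoints, so coinciding endpoints are treated
   apart. *)
have [D0|D0] := eqVneq (b - a + h) 0.
  have -> : h = 0 by lra.
  by rewrite !addr0.
have {}D0 : 0 < b - a + h by rewrite lt_def D0/=; lra.
pose t := h / (b - a + h).
have t0 : 0 <= t by rewrite divr_ge0// ltW.
have t1 : t <= 1 by rewrite ler_pdivrMr// mul1r; lra.
have tD : t * (b - a + h) = h by rewrite divfK// gt_eqF.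
have bh0 : 0 <= b + h by lra.
have := concave_psi a (b + h) t a0 bh0.
rewrite t0 t1 => /(_ isT).
have -> : t * a + (1 - t) * (b + h) = b by lra.
have := concave_psi a (b + h) (1 - t) a0 bh0.
rewrite subr_ge0 t1 lerBlDr lerDl t0 => /(_ isT).
have -> : (1 - t) * a + (1 - (1 - t)) * (b + h) = a + h by lra.
lra.
Qed.

Hypothesis psi0 : psi 0 = 0.

(** Translate the clipped pair to the right until its larger element reaches [u]. By concavity the
    [psi]-gap does not grow, so the translated smaller element belongs to the set whose infimum is
    [psi_inv], while the distance is unchanged. *)
Lemma clipping_sensitivity a b u sigma : 0 <= a -> 0 <= b -> 0 <= u ->
  0 <= sigma -> `|psi a - psi b| <= sigma ->
  `|Num.min a u - Num.min b u| <=
  u - psi_inv psi (Num.max 0 (psi u - sigma)).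
Proof.
wlog ab : a b / a <= b.
  move=> H a0 b0 *; have [ab|/ltW ba] := leP a b; first exact: H.
  by rewrite distrC; apply: H => //; rewrite distrC.
move=> a0 b0 u0 s0; rewrite ler_distl => /andP[sab _].
set a' := Num.min a u; set b' := Num.min b u.
have a'0 : 0 <= a' by rewrite le_min a0.
have a'b' : a' <= b' by rewrite le_min !ge_min ab/= lexx orbT.
have b'u : b' <= u by rewrite ge_min lexx orbT.
(* Clipping does not widen the [psi]-gap: it lowers only the upper value, or it merges the two. *)
have sab' : psi b' - psi a' <= sigma.
  rewrite /a' /b'; have [bu|/ltW ub] := leP b u.
    by rewrite min_l ?(le_trans ab)//; lra.
  have := psi_homo u b u0 ub.
  have [au|ua] := leP a u; first by lra.
  by rewrite subrr.
have x0 : 0 <= a' + (u - b') by lra.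
rewrite distrC ger0_norm ?subr_ge0//.
suff : psi_inv psi (Num.max 0 (psi u - sigma)) <= a' + (u - b') by lra.
apply: ge_inf; first by exists 0 => x [].
split => //; rewrite ge_max; apply/andP; split.
  by rewrite -psi0; exact: psi_homo.
have ub0 : 0 <= u - b' by lra.
have := @neighbor_function_increment a' b' (u - b') a'0 a'b' ub0.
rewrite subrKC; lra.
Qed.
End clipping.

(** * Gaussian noise laws as probability measures, and their densities *)

Section gauss_probability.
Context {R : realType}.

(** A name on which the probability structure is declared, for the point mass and the normal law
    alike; it stays convertible to [gauss_law]. *)
Definition gauss_prob (c s : R) : set R -> \bar R := gauss_law c s.

Section instances.
Variables c s : R.

Let gauss0 : gauss_prob c s set0 = 0%E.
Proof.
rewrite /gauss_prob /gauss_law; case: ifP => _; last exact: measure0.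
exact: (@measure0 _ R).
Qed.

Let gauss_ge0 A : (0 <= gauss_prob c s A)%E.
Proof. by rewrite /gauss_prob /gauss_law; case: ifP => _; exact: measure_ge0. Qed.

Let gauss_sigma_additive : semi_sigma_additive (gauss_prob c s).
Proof.
rewrite /gauss_prob /gauss_law; case: ifP => _.
  exact: (@measure_semi_sigma_additive _ R).
exact: (@measure_semi_sigma_additive _ (measurableTypeR R) _ (normal_prob c s)).
Qed.

HB.instance Definition _ := isMeasure.Build _ _ _
  (gauss_prob c s) gauss0 gauss_ge0 gauss_sigma_additive.

Let gauss_setT : gauss_prob c s setT = 1%E.
Proof.
rewrite /gauss_prob /gauss_law; case: ifP => _.
  exact: (probability_setT (\d_c : probability R R)).
exact: (probability_setT (normal_prob c s)).
Qed.

HB.instance Definition _ :=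
  @Measure_isProbability.Build _ _ R (gauss_prob c s) gauss_setT.

End instances.

(* [R] and [measurableTypeR R] carry the same measurable sets under different
   displays, and integrals over the two are not convertible. *)
Lemma integral_normal_prob_display (c s : R) (f : R -> \bar R) :
  measurable_fun setT f -> (forall x, 0 <= f x)%E ->
  (@integral _ R R (normal_prob c s) setT f =
   @integral _ (measurableTypeR R) R (normal_prob c s) setT f)%E.
Proof.
move=> mf f0.
have mid : measurable_fun [set: measurableTypeR R] (idfun : measurableTypeR R -> R).
  by move=> _ A mA; rewrite setTI.
exact: (@ge0_integral_pushforward _ _ (measurableTypeR R) R R idfun mid
  (normal_prob c s) setT f measurableT mf (fun x _ => f0 x)).
Qed.

Lemma integral_normal_prob (c s : R) (f : R -> \bar R) :
  measurable_fun setT f -> (forall x, 0 <= f x <= 1)%E ->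
  (@integral _ R R (normal_prob c s) setT f =
   \int[lebesgue_measure]_x (f x * (normal_pdf c s x)%:E))%E.
Proof.
move=> mf f01.
rewrite integral_normal_prob_display//; last by move=> x; have /andP[] := f01 x.
have numu := normal_prob_dominates c s.
have mf' : measurable_fun [set: measurableTypeR R] f.
  by move=> _ A mA; exact: mf.
have mpdf : measurable_fun [set: measurableTypeR R]
    (fun x => (normal_pdf c s x)%:E).
  by apply/measurable_EFinP; move=> _ A mA; exact: (measurable_normal_pdf c s).
have fi : (normal_prob c s).-integrable [set: measurableTypeR R] f.
  apply: (@le_integrable _ _ _ (normal_prob c s) _ measurableT f (cst 1%E))
    => //.
    move=> x _; rewrite gee0_abs ?abse1; by have /andP[] := f01 x.
  exact: finite_measure_integrable_cst.
rewrite -(Radon_Nikodym_change_of_variables numu measurableT fi).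
apply: ae_eq_integral => //.
- exact: emeasurable_funM.
- exact: emeasurable_funM.
(* The Radon-Nikodym derivative and [normal_pdf] have the same integral over every measurable set,
   hence agree almost everywhere. *)
- apply: ae_eqe_mul2l; apply: integral_ae_eq => //.
  + exact: Radon_Nikodym_integrable.
  + by move=> E _ mE; rewrite -Radon_Nikodym_integral.
Qed.
End gauss_probability.

(** * Likelihood ratios and tails of normal laws *)

Section gauss_cdf.
Context {R : realType}.
Implicit Types (c s t x y : R).

(** With a common scale the quadratic terms cancel, so the log-likelihood ratio is affine in [y]
    with slope of the sign of [c' - c]. *)
Lemma normal_pdf_ratio c c' s y : s != 0 ->
  normal_pdf c' s y =
  expR ((c' - c) * (y *+ 2 - c - c') / (s ^+ 2 *+ 2)) * normal_pdf c s y.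
Proof.
move=> s0; rewrite !normal_pdfE//= mulrCA; congr *%R.
rewrite -expRD -mulrDl /normal_fun.
suff -> : - (y - c') ^+ 2 =
  (c' - c) * (y *+ 2 - c - c') + - (y - c) ^+ 2 by [].
ring.
Qed.

Lemma Phi_nondecreasing x y : x <= y -> (Phi x <= Phi y)%E.
Proof.
move=> xy; rewrite /Phi; apply: le_measure; rewrite ?inE//.
exact: subset_itvl.
Qed.

Lemma normal_pdf_std c s y : 0 < s ->
  normal_pdf c s y = normal_pdf 0 1 ((y - c) / s) / s.
Proof.
move=> s0; rewrite !normal_pdfE ?oner_eq0 ?gt_eqF//=.
rewrite mulrAC /normal_fun /normal_peak; congr (_ * expR _).
  rewrite expr1n mul1r -mulrnAr sqrtrM ?sqr_ge0// sqrtr_sqr gtr0_norm//.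
  by rewrite invfM mulrC.
by field; rewrite ?gt_eqF.
Qed.

Lemma normal_prob_le c s t : 0 < s ->
  normal_prob c s `]-oo, t] = Phi ((t - c) / s).
Proof.
move=> s0; pose F : R -> R := fun y => (y - c) / s.
have dF : F^`()%classic = cst s^-1.
  apply/funext => x; rewrite /F derive1E deriveM// deriveD// derive_cst scaler0.
  by rewrite add0r derive_id derive_cst addr0 scaler1.
rewrite /Phi /normal_prob.
rewrite (@increasing_ge0_integration_by_substitutionNy _ F (normal_pdf 0 1) t).
- by apply: eq_integral => x _; rewrite dF normal_pdf_std.
- by move=> x y _ _ xy; rewrite /F ltr_pM2r ?invr_gt0// ltrD2r.
- by rewrite dF => x _; exact: cvg_cst.
- by rewrite dF; exact: is_cvg_cst.
- by rewrite dF; exact: cvg_cst.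
- split => //.
  apply: (@cvgM R); last exact: cvg_cst.
  by apply: (@cvgB _ R^o); [exact: cvg_at_left_filter|exact: cvg_cst].
- apply/gt0_cvgMlNy; first by rewrite invr_gt0.
  exact: cvg_addrr_Ny.
- apply: continuous_subspaceT; apply: continuous_normal_pdf; exact: oner_neq0.
- by move=> x _; exact: normal_pdf_ge0.
Qed.

(** The decreasing substitution [F] reflects the upper tail onto a lower one; the standard density
    is even. *)
Lemma normal_prob_ge c s t : 0 < s ->
  normal_prob c s `[t, +oo[ = Phi ((c - t) / s).
Proof.
move=> s0; pose F : R -> R := fun y => (c - y) / s.
have dF : F^`()%classic = cst (- s^-1).
  apply/funext => x; rewrite /F derive1E deriveM// deriveB// derive_cst scaler0.
  by rewrite !add0r derive_id derive_cst sub0r scalerN scaler1.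
rewrite /Phi /normal_prob.
rewrite (@decreasing_ge0_integration_by_substitutiony _ F (normal_pdf 0 1) t).
- apply: eq_integral => x _; rewrite fctE dF/= opprK normal_pdf_std//.
  congr (_%:E); congr (_ / _).
  rewrite !normal_pdfE ?oner_neq0//= /normal_fun !subr0 /F.
  by rewrite -(opprB x c) (mulNr (x - c)) sqrrN.
- by move=> x y _ _ xy; rewrite /F ltr_pM2r ?invr_gt0// ltrD2l ltrN2.
- by rewrite dF => x _; exact: cvg_cst.
- by rewrite dF; exact: is_cvg_cst.
- by rewrite dF; exact: is_cvg_cst.
- split => //.
  apply: (@cvgM R); last exact: cvg_cst.
  by apply: (@cvgB _ R^o); [exact: cvg_cst|exact: cvg_at_right_filter].
- apply/gt0_cvgMlNy; first by rewrite invr_gt0.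
  exact: (cvg_comp _ _ (proj2 (cvgNrNy idfun) cvg_id) (cvg_addrl_Ny c)).
- apply: continuous_subspaceT; apply: continuous_normal_pdf; exact: oner_neq0.
- by move=> x _; exact: normal_pdf_ge0.
Qed.
End gauss_cdf.

(** * The Neyman-Pearson inequality for two Gaussians *)

Section neyman_pearson.
Context {R : realType}.
Implicit Types (c s l : R).

Lemma integral_gauss_prob c s (f : R -> \bar R) : s != 0 ->
  measurable_fun setT f -> (forall x, 0 <= f x <= 1)%E ->
  (\int[gauss_prob c s]_x f x =
   \int[lebesgue_measure]_x (f x * (normal_pdf c s x)%:E))%E.
Proof.
move=> s0 mf f01; rewrite -integral_normal_prob//.
by rewrite /gauss_prob /gauss_law (negbTE s0).
Qed.

(** Pointwise, [\1_A - g] and [normal_pdf c' s - l * normal_pdf c s] never have opposite signs;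
    their product is integrated. Terms are placed so that both sides are sums of nonnegative
    quantities, avoiding extended subtraction. *)
Lemma gauss_neyman_pearson c c' s l (A : set R) (g : R -> \bar R) :
  s != 0 -> 0 <= l -> measurable A ->
  (forall y, A y -> l * normal_pdf c s y <= normal_pdf c' s y) ->
  (forall y, ~ A y -> normal_pdf c' s y <= l * normal_pdf c s y) ->
  measurable_fun setT g -> (forall x, 0 <= g x <= 1)%E ->
  (\int[gauss_prob c' s]_x g x + l%:E * gauss_prob c s A <=
   l%:E * \int[gauss_prob c s]_x g x + gauss_prob c' s A)%E.
Proof.
move=> s0 l0 mA inA outA mg g01.
have gA k : gauss_prob k s A = (\int[gauss_prob k s]_x (\1_A x)%:E)%E.
  by rewrite integral_indic// setIT.
have mA1 : measurable_fun setT (fun x : R => (\1_A x)%:E : \bar R).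
  exact/measurable_EFinP/measurable_indic.
have A01 (x : R) : (0 <= ((\1_A x)%:E : \bar R) <= 1)%E.
  by rewrite !lee_fin indicE; case: (_ \in _); rewrite ?lexx ?ler01.
rewrite !gA !integral_gauss_prob//.
have mpdf k (f : R -> \bar R) : measurable_fun setT f ->
    measurable_fun [set: measurableTypeR R]
      (fun x => f x * (normal_pdf k s x)%:E)%E.
  move=> mf; apply: emeasurable_funM; first by move=> _ B mB; exact: mf.
  by apply/measurable_EFinP; move=> _ B mB; exact: (measurable_normal_pdf k s).
have pdf0 k (f : R -> \bar R) : (forall x, 0 <= f x <= 1)%E -> forall x,
    setT x -> (0 <= f x * (normal_pdf k s x)%:E)%E.
  by move=> f01 x _; rewrite mule_ge0 ?lee_fin ?normal_pdf_ge0//;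
    have /andP[] := f01 x.
have mlpdf k (f : R -> \bar R) : measurable_fun setT f ->
    measurable_fun [set: measurableTypeR R]
      (fun x => l%:E * (f x * (normal_pdf k s x)%:E))%E.
  by move=> mf; apply: measurable_funeM; exact: mpdf.
have lpdf0 k (f : R -> \bar R) : (forall x, 0 <= f x <= 1)%E -> forall x,
    setT x -> (0 <= l%:E * (f x * (normal_pdf k s x)%:E))%E.
  by move=> f01 x _; rewrite mule_ge0 ?lee_fin//; exact: pdf0.
rewrite -!ge0_integralZl//; [|exact: mpdf|exact: pdf0|exact: mpdf|exact: pdf0].
rewrite -!ge0_integralD//; try by
  [exact: mpdf|exact: pdf0|exact: mlpdf|exact: lpdf0].
apply: ge0_le_integral => //.
- by move=> x _; apply: adde_ge0;
    [exact: (pdf0 c' g)|exact: (lpdf0 c (fun x => (\1_A x)%:E))].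
- by apply: emeasurable_funD;
    [exact: (mpdf c' g)|exact: (mlpdf c (fun x => (\1_A x)%:E))].
- by apply: emeasurable_funD;
    [exact: (mlpdf c g)|exact: (mpdf c' (fun x => (\1_A x)%:E))].
move=> x _; have := g01 x; case: (g x) => [r| |]; last 2 first.
- by move=> /andP[_]; rewrite leye_eq.
- by move=> /andP[]; rewrite leeNy_eq.
rewrite !lee_fin => /andP[r0 r1].
rewrite indicE; have [xA|xA] := boolP (x \in A).
  have := inA x (set_mem xA).
  move: (normal_pdf c s x) (normal_pdf c' s x) => f f' ff'.
  have : 0 <= (1 - r) * (f' - l * f) by rewrite mulr_ge0 ?subr_ge0.
  by rewrite !mul1r; lra.
have := outA x (fun h => negP xA (mem_set h)).
move: (normal_pdf c s x) (normal_pdf c' s x) => f f' ff'.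
have : 0 <= r * (l * f - f') by rewrite mulr_ge0 ?subr_ge0.
by rewrite !mul0r; lra.
Qed.

(** Here [l] is the likelihood ratio at the endpoint of a half-line, and [a], [b] are the
    probabilities of that half-line under the two laws. None of them depends on [g], which lets the
    inequality be integrated later. *)
Lemma gauss_tradeoff c c' s e x : 0 < s -> `|c' - c| <= e * s ->
  exists l a b : R, [/\ [/\ 0 <= l, 0 <= a & 0 <= b],
    Phi x = a%:E, (b%:E <= Phi (x + e))%E &
    forall g : R -> \bar R, measurable_fun setT g ->
      (forall y, 0 <= g y <= 1)%E ->
      (\int[gauss_prob c' s]_y g y + (l * a)%:E <=
       l%:E * \int[gauss_prob c s]_y g y + b%:E)%E].
Proof.
move=> s0 cc'.
have sn0 : s != 0 by rewrite gt_eqF.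
have gauss_normal k A : gauss_prob k s A = normal_prob k s A.
  by rewrite /gauss_prob /gauss_law (negbTE sn0).
pose l (t : R) := expR ((c' - c) * (t *+ 2 - c - c') / (s ^+ 2 *+ 2)).
have lmono t y : 0 <= (c' - c) * (y - t) ->
    l t * normal_pdf c s y <= normal_pdf c' s y.
  move=> ty; rewrite (normal_pdf_ratio c c')// ler_wpM2r ?normal_pdf_ge0//.
  rewrite ler_expR ler_pM2r ?invr_gt0 ?pmulrn_lgt0 ?exprn_gt0//.
  move: ty; rewrite !mulr2n; nra.
have lmono' t y : (c' - c) * (y - t) <= 0 ->
    normal_pdf c' s y <= l t * normal_pdf c s y.
  move=> ty; rewrite (normal_pdf_ratio c c')// ler_wpM2r ?normal_pdf_ge0//.
  rewrite ler_expR ler_pM2r ?invr_gt0 ?pmulrn_lgt0 ?exprn_gt0//.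
  move: ty; rewrite !mulr2n; nra.
have fin k A : measurable A -> gauss_prob k s A \is a fin_num.
  by move=> mA; exact: fin_num_measure.
(* The ratio is monotone, so it is enough to find a half-line [A] with endpoint [t], unbounded in
   the direction from [c] to [c']. *)
suff [A [t [mA PA PA' inA outA]]] : exists (A : set R) t, [/\ measurable A,
    gauss_prob c s A = Phi x, (gauss_prob c' s A <= Phi (x + e))%E,
    (forall y, A y -> 0 <= (c' - c) * (y - t)) &
    (forall y, ~ A y -> (c' - c) * (y - t) <= 0)].
  exists (l t), (fine (gauss_prob c s A)), (fine (gauss_prob c' s A)).
  split; rewrite ?fineK ?fin//.
    by split; rewrite ?expR_ge0 ?fine_ge0.
  move=> g mg g01; rewrite EFinM !fineK ?fin//.
  apply: gauss_neyman_pearson => //; first exact: expR_ge0.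
  - by move=> y /inA; exact: lmono.
  - by move=> y /outA; exact: lmono'.
have [cle|/ltW cge] := leP c c'.
(* The endpoint is the one giving [A] probability [Phi x] under the law centred at [c]; moving the
   centre to [c'] raises the argument of [Phi] by [(c' - c) / s], at most [e]. *)
- exists `[c - s * x, +oo[%classic, (c - s * x); split => //.
  + rewrite gauss_normal normal_prob_ge//; congr Phi.
    by rewrite opprB addrC subrK mulrAC divff// mul1r.
  + rewrite gauss_normal normal_prob_ge//; apply: Phi_nondecreasing.
    rewrite ler_pdivrMr// mulrDl.
    move: cc'; rewrite ger0_norm ?subr_ge0//; lra.
  + by move=> y /=; rewrite in_itv/= andbT => ty; rewrite mulr_ge0// subr_ge0.
  + move=> y /=; rewrite in_itv/= andbT => /negP; rewrite -ltNge => ty.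
    by rewrite mulr_ge0_le0 ?subr_ge0// subr_le0 ltW.
- exists `]-oo, c + s * x]%classic, (c + s * x); split => //.
  + rewrite gauss_normal normal_prob_le//; congr Phi.
    by rewrite addrC addKr mulrAC divff// mul1r.
  + rewrite gauss_normal normal_prob_le//; apply: Phi_nondecreasing.
    rewrite ler_pdivrMr// mulrDl.
    move: cc'; rewrite ler0_norm ?subr_le0//; lra.
  + by move=> y /=; rewrite in_itv/= => ty; rewrite mulr_le0// subr_le0.
  + move=> y /=; rewrite in_itv/= => /negP; rewrite -ltNge => ty.
    by rewrite mulr_le0_ge0 ?subr_le0// subr_ge0 ltW.
Qed.
End neyman_pearson.

(** * Iterated integrals over independent coordinates *)

Section indep_int_theory.
Context {R : realType} {I : eqType}.
Implicit Types (p q : I -> probability R R) (r : seq I).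
Local Open Scope ereal_scope.

Lemma indep_int_ge0 p r (f : seq R -> \bar R) :
  (forall s, 0 <= f s) ->
  0 <= indep_int [seq (p k : set R -> \bar R) | k <- r] f.
Proof.
elim: r f => [|k r IH] f f0 //=.
by apply: integral_ge0 => x _; exact: IH.
Qed.

(** The parameter space [Y] is arbitrary so that the induction can move each sampled coordinate into
    it, replacing [Y] by [Y * R]; Fubini-Tonelli then integrates that coordinate out. *)
Lemma measurable_indep_int p r n d (Y : measurableType d)
    (F : Y -> seq R -> \bar R) :
  size r = n -> (forall y s, 0 <= F y s) ->
  measurable_fun setT (fun z : Y * n.-tuple R => F z.1 (tval z.2)) ->
  measurable_fun setT
    (fun y => indep_int [seq (p k : set R -> \bar R) | k <- r] (F y)).
Proof.
elim: r n d Y F => [|k r IH] [|n] d Y F //= sz F0 mF; last first.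
  move: sz => [sz].
  pose F' (z : Y * R) s := F z.1 (z.2 :: s).
  have mF' : measurable_fun setT (fun z : Y * R =>
      indep_int [seq (p k : set R -> \bar R) | k <- r] (F' z)).
    apply: (IH n) => //; first by move=> *; exact: F0.
    apply: (measurableT_comp mF (_ : measurable_fun setT
      (fun z : (Y * R) * n.-tuple R =>
        (z.1.1, [the n.+1.-tuple R of z.1.2 :: z.2])))).
    apply: measurable_fun_pair.
      exact: (measurableT_comp measurable_fst measurable_fst).
    apply: measurable_cons => //.
    exact: (measurableT_comp measurable_snd measurable_fst).
  exact: (@measurable_fun_fubini_tonelli_F _ _ Y R R (p k) _ mF'
    (fun z => indep_int_ge0 p r (F' z) (fun s => F0 _ _))).
apply: (measurableT_comp mF (_ : measurable_fun setT
  (fun y => (y, [tuple] : 0.-tuple R)))).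
by apply: measurable_fun_pair.
Qed.

Lemma measurable_indep_int_cons p r n (f : seq R -> \bar R) :
  size r = n -> (forall s, 0 <= f s) ->
  measurable_fun setT (fun t : n.+1.-tuple R => f (tval t)) ->
  measurable_fun setT (fun x : R =>
    indep_int [seq (p k : set R -> \bar R) | k <- r] (fun s => f (x :: s))).
Proof.
move=> sz f0 mf; apply: (measurable_indep_int _ _ _ _ _ _ sz) => //.
by apply: (measurableT_comp mf (_ : measurable_fun setT
  (fun z : R * n.-tuple R => [the n.+1.-tuple R of z.1 :: z.2])));
  exact: measurable_cons.
Qed.

Lemma measurable_tuple_section n (f : seq R -> \bar R) (x : R) :
  measurable_fun setT (fun t : n.+1.-tuple R => f (tval t)) ->
  measurable_fun setT (fun t : n.-tuple R => f (x :: tval t)).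
Proof.
move=> mf; by apply: (measurableT_comp mf (_ : measurable_fun setT
  (fun t : n.-tuple R => [the n.+1.-tuple R of x :: t])));
  exact: measurable_cons.
Qed.

Lemma indep_int_le1 p r n (f : seq R -> \bar R) :
  size r = n -> (forall s, 0 <= f s <= 1) ->
  measurable_fun setT (fun t : n.-tuple R => f (tval t)) ->
  indep_int [seq (p k : set R -> \bar R) | k <- r] f <= 1.
Proof.
elim: r n f => [|k r IH] [|n] f //= sz f01 mf.
  by have /andP[] := f01 [::].
move: sz => [sz].
have f0 s : 0 <= f s by have /andP[] := f01 s.
rewrite -(probability_setT (p k)) -[leRHS]mul1e -integral_cst//.
apply: ge0_le_integral => //.
- by move=> x _; apply: indep_int_ge0 => s; exact: f0.
- exact: (measurable_indep_int_cons p r n).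
- by move=> x _; apply: (IH n) => //; exact: measurable_tuple_section.
Qed.

(** Induction along [r]. At [i0] the integral over the remaining coordinates serves as the test [g];
    at an earlier coordinate the two laws coincide and the inequality is integrated. *)
Lemma indep_int_tradeoff p q r n (i0 : I) (l a b : R) (f : seq R -> \bar R) :
  uniq r -> i0 \in r -> size r = n ->
  (0 <= l)%R -> (0 <= a)%R -> (0 <= b)%R ->
  (forall k, k != i0 -> p k = q k) ->
  (forall g : R -> \bar R, measurable_fun setT g -> (forall y, 0 <= g y <= 1) ->
    \int[q i0]_y g y + (l * a)%:E <= l%:E * \int[p i0]_y g y + b%:E) ->
  (forall s, 0 <= f s <= 1) ->
  measurable_fun setT (fun t : n.-tuple R => f (tval t)) ->
  indep_int [seq (q k : set R -> \bar R) | k <- r] f + (l * a)%:E <=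
  l%:E * indep_int [seq (p k : set R -> \bar R) | k <- r] f + b%:E.
Proof.
move=> + + + l0 a0 b0 pq tradeoff.
elim: r n f => [|k r IH] [|n] f //= /andP[kr ur] + sz f01 mf.
move: sz => [sz].
have f0 s : 0 <= f s by have /andP[] := f01 s.
rewrite inE => /predU1P[i0k|i0r].
  subst k.
  (* As [r] is duplicate-free, [i0] does not recur in the tail, so one and the same test is used on
     both sides. *)
  have -> : [seq (p k : set R -> \bar R) | k <- r] =
            [seq (q k : set R -> \bar R) | k <- r].
    by apply/eq_in_map => k kr'; rewrite pq//; apply: contraNneq kr => <-.
  apply: tradeoff; first exact: (measurable_indep_int_cons q r n).
  move=> x; rewrite indep_int_ge0//= (@indep_int_le1 _ _ n)//.
  exact: measurable_tuple_section.
rewrite pq; last by apply: contraNneq kr => ->.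
have cst_int (c : \bar R) : \int[q k]_x cst c x = c.
  by rewrite integral_cst// [X in c * X]probability_setT mule1.
(* The constants become integrals over a probability, so that the inequality can be proved under the
   integral sign. *)
rewrite -[X in _ + X <= _]cst_int -[X in _ <= _ + X]cst_int.
have la0 : 0 <= (l * a)%:E by rewrite lee_fin mulr_ge0.
have mI (p' : I -> probability R R) : measurable_fun setT (fun x : R =>
    indep_int [seq (p' k : set R -> \bar R) | k <- r] (fun s => f (x :: s))).
  exact: (measurable_indep_int_cons p' r n).
have I0 (p' : I -> probability R R) (x : R) :
    0 <= indep_int [seq (p' k : set R -> \bar R) | k <- r] (fun s => f (x :: s)).
  exact: indep_int_ge0.
rewrite -ge0_integralZl// -!ge0_integralD//=; last 2 first.
  by move=> x _; rewrite mule_ge0.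
  exact: measurable_funeM.
apply: ge0_le_integral => //.
- by move=> x _; rewrite adde_ge0.
- exact: emeasurable_funD.
- by apply: emeasurable_funD => //; exact: measurable_funeM.
- by move=> x _; apply: (IH n) => //; exact: measurable_tuple_section.
Qed.
End indep_int_theory.

(** The set whose infimum is [Phi_inv p], translated by [mu], lies in the one for [q]; if it is
    empty, the bound is [+oo]. *)
Lemma Phi_inv_le_shift (R : realType) (p q : \bar R) (mu : R) :
  (forall x, p <= Phi x -> q <= Phi (x + mu)%R)%E ->
  (Phi_inv q <= Phi_inv p + mu%:E)%E.
Proof.
move=> pq; rewrite -leeBlDr//.
apply: le_ereal_inf_tmp => _ [x px <-].
rewrite leeBlDr// -EFinD.
by apply: ereal_inf_lbound; exists (x + mu) => //=; exact: pq.
Qed.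

(** * Datasets with equal public attributes *)

Section neighbors.
Context {R : realType} (P : Type) (m L : nat) (J : finType).
Variables (psi : R -> R) (sigma : 'I_m -> R) (G : P -> 'I_L).
Variables (i : 'I_m) (u : J -> R) (D1 D2 : @dataset R P m J).
Hypothesis pub12 : forall j, pub (D2 j) = pub (D1 j).

Lemma ustar_pub l : ustar G u D2 l = ustar G u D1 l.
Proof. by apply: eq_bigl => j; rewrite pub12. Qed.

Lemma pnc_sd_pub mu l :
  pnc_sd psi sigma mu G i u D2 l = pnc_sd psi sigma mu G i u D1 l.
Proof. by rewrite /pnc_sd /pnc_Delta ustar_pub. Qed.

Variable j : J.
Hypothesis D21 : forall j', j' != j -> D2 j' = D1 j'.

Lemma group_clipped_sum_other l : l != G (pub (D1 j)) ->
  group_clipped_sum G i u D2 l = group_clipped_sum G i u D1 l.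
Proof.
move=> lj; apply: eq_big => k; first by rewrite pub12.
rewrite pub12 ustar_pub => /eqP kl; rewrite D21//.
by apply: contraNneq lj => <-; rewrite kl.
Qed.

(** The changed record keeps its group and the clipping bound is public, so all other summands
    cancel. *)
Lemma group_clipped_sum_changed (l := G (pub (D1 j))) :
  group_clipped_sum G i u D2 l - group_clipped_sum G i u D1 l =
  Num.min (conf (D2 j) i) (ustar G u D1 l) -
  Num.min (conf (D1 j) i) (ustar G u D1 l).
Proof.
rewrite /group_clipped_sum (bigD1 j) ?pub12//= [X in _ - X](bigD1 j)//=.
rewrite ustar_pub opprD addrACA -[RHS]addr0; congr +%R; apply/eqP.
rewrite subr_eq0; apply/eqP/eq_big => k; first by rewrite pub12.
by move=> /andP[_ kj]; rewrite D21.
Qed.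
End neighbors.

Theorem theorem6p9 (R : realType) (P : Type) (m L : nat) (J : finType)
  (psi : R -> R) (sigma : 'I_m -> R) (mu : R) (G : P -> 'I_L)
  (i : 'I_m) (u : J -> R) :
  neighbor_function psi -> psi 0 = 0 ->
  (forall k, 0 <= sigma k) -> 0 < mu ->
  (forall j, 0 <= u j) ->
  gaussian_EDP (pnc_mechanism psi sigma mu G i u) psi sigma mu.
Proof.
move=> npsi psi0 sigma0 mu0 u0 D1 D2 nn1 nn2 [j [D21 [pubj close]]] S mS.
have pub12 k : pub (D2 k) = pub (D1 k).
  by have [->|kj] := eqVneq k j; [rewrite pubj|rewrite D21].
pose l0 := G (pub (D1 j)).
have sdE := pnc_sd_pub P m L J psi sigma G i u D1 D2 pub12 mu.
pose T := group_clipped_sum G i u.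
pose sd := pnc_sd psi sigma mu G i u D1.
have TE l : l != l0 -> T D2 l = T D1 l.
  exact: group_clipped_sum_other.
have ustar0 : 0 <= ustar G u D1 l0.
  rewrite /ustar; elim/big_ind : _ => // x y x0 y0.
  by rewrite le_max x0.
(* The right side is [pnc_Delta] of the affected group: the means differ by at most [mu] standard
   deviations. *)
have sens : `|T D2 l0 - T D1 l0| <= mu * sd l0.
  rewrite /sd /pnc_sd mulrC divfK ?gt_eqF//.
  rewrite group_clipped_sum_changed// distrC.
  exact: clipping_sensitivity.
have sd0 : 0 <= sd l0.
  by rewrite -(pmulr_rge0 _ mu0); exact: le_trans sens.
(* The released variances are frozen at those of [D1], so both datasets face the same event on the
   noisy sums. *)
pose A := [set s : seq R | exists t : L.-tuple R, tval t = s /\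
  S (t, pnc_variances psi sigma mu G i u D1)].
pose f (s : seq R) : \bar R := (\1_A s)%:E.
pose p D l : probability R R := gauss_prob (T D l) (sd l).
pose Q D := indep_int [seq (p D l : set R -> \bar R) | l <- enum 'I_L] f.
have mechE D : (forall l, pnc_sd psi sigma mu G i u D l = sd l) ->
    pnc_mechanism psi sigma mu G i u D S = Q D.
  move=> sdD; rewrite /pnc_mechanism.
  have -> : pnc_variances psi sigma mu G i u D =
            pnc_variances psi sigma mu G i u D1.
    by apply: eq_from_tnth => l; rewrite !tnth_mktuple sdD.
  have lawsE : [seq gauss_law (group_clipped_sum G i u D l)
               (pnc_sd psi sigma mu G i u D l) | l <- enum 'I_L] =
            [seq (p D l : set R -> \bar R) | l <- enum 'I_L].
    by apply: eq_map => l; rewrite sdD.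
  exact: (f_equal (fun nus => indep_int nus f) lawsE).
rewrite !mechE//.
(* At scale 0 the noise is a point mass, but then [sens] freezes the sum. *)
have [sdl0|sdl0] := eqVneq (sd l0) 0.
  have -> : Q D2 = Q D1.
    apply: (f_equal (fun nus => indep_int nus f)); apply: eq_map => l.
    have TE0 : T D2 l0 = T D1 l0.
      by move: sens; rewrite sdl0 mulr0 normr_le0 subr_eq0 => /eqP.
    have Tl : T D2 l = T D1 l by have [->|/TE] := eqVneq l l0.
    by rewrite /p Tl.
  apply: Phi_inv_le_shift => x px; apply: (le_trans px).
  by apply: Phi_nondecreasing; rewrite lerDl ltW.
apply: Phi_inv_le_shift => x px.
have sdpos : 0 < sd l0 by rewrite lt_def sdl0.
have [l [a [b [[l_ge0 a0 b0] xa bx tradeoff]]]] :=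
  gauss_tradeoff (T D1 l0) (T D2 l0) (sd l0) mu x sdpos sens.
have f01 s : (0 <= f s <= 1)%E.
  by rewrite !lee_fin indicE; case: (_ \in _); rewrite ?lexx ?ler01.
(* On tuples the event is the section of [S] at a fixed variance vector. *)
have mf : measurable_fun setT (fun t : L.-tuple R => f (tval t)).
  have -> : (fun t : L.-tuple R => f (tval t)) =
    EFin \o \1_[set t | S (t, pnc_variances psi sigma mu G i u D1)].
    apply/funext => t; rewrite /f /= !indicE; congr (_%:R%:E); congr nat_of_bool.
    apply/idP/idP; rewrite !inE /=.
      by move=> [t' [/val_inj->]].
    by move=> St; exists t.
  apply/measurable_EFinP/measurable_indic.
  rewrite -[X in measurable X]setTI.
  exact: (measurable_fun_pair (@measurable_id _ _ _)
    (@measurable_cst _ _ _ _ _ _)).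
have p12 k : k != l0 -> p D1 k = p D2 k by move=> /TE; rewrite /p => ->.
have Q12 : (Q D2 + (l * a)%:E <= l%:E * Q D1 + b%:E)%E.
  exact: (indep_int_tradeoff (p D1) (p D2) (enum 'I_L) L l0 l a b f
    (enum_uniq _) (mem_enum _ _) (size_enum_ord L) l_ge0 a0 b0 p12
    tradeoff f01 mf).
have Q0 : (0 <= Q D1)%E.
  by apply: indep_int_ge0 => s; have /andP[] := f01 s.
(* From [Q D1 <= a] and [0 <= l], the inequality [Q12] leaves [Q D2 <= b]; [px] and [Q0] exclude
   infinite values of [Q D1]. *)
apply: le_trans bx; move: px Q12 Q0; rewrite xa.
move: (Q D1) (Q D2) => [r| |] q //; rewrite lee_fin => ra + _.
rewrite -EFinM -EFinD -leeBrDr// => /le_trans; apply.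
rewrite -EFinB lee_fin; have := ler_wpM2l l_ge0 ra; lra.
Qed.
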